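(* For $n\ge1$ define the polynomials in $Y,A,B$ $$e_n=\sum_{\substack{\alpha,\beta\in NC(n)\\ \alpha\wedge\beta=0_n,\ \alpha\vee\beta=1_n}} Y^{\|\alpha^{-1}\beta\|}A^{\|\alpha\|}B^{\|\beta\|},\qquad f_n=\sum_{\substack{\alpha,\beta\in NC(n)\\ \alpha\vee\beta=1_n}} Y^{\|\alpha^{-1}\beta\|}A^{n-1-\|\alpha\|}B^{n-1-\|\beta\|},$$ $$g_n=\sum_{\alpha,\beta\in NC(n)} Y^{\|\alpha^{-1}\beta\|}A^{\|\alpha^{-1}(\alpha\vee\beta)\|}B^{\|\beta^{-1}(\alpha\vee\beta)\|}.$$ Then $\mathcal F$ maps $(e_n)_{n\ge1}$ to $(f_n)_{n\ge1}$ and maps $(f_n)_{n\ge1}$ to $(g_n)_{n\ge1}$; that is, for all $n\ge1$, $$f_n=\sum_{\sigma\in NC(n)}\prod_{c\in\sigma} e_{|c|},\qquad g_n=\sum_{\sigma\in NC(n)}\prod_{c\in\sigma} f_{|c|},$$ where the products run over the blocks $c$ of $\sigma$ and $|c|$ is the size of $c$.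
   Context: $\|\sigma\|$ denotes the length of a permutation $\sigma\in S_n$ (minimal number of transpositions with product $\sigma$; equals $n$ minus the number of cycles). $NC(n)$ is the lattice of non-crossing partitions of $\{1,\dots,n\}$ under reverse refinement, with meet $\wedge$, join $\vee$, minimum $0_n$ (all singletons) and maximum $1_n$ (single block). Each $\alpha\in NC(n)$ is identified with the permutation whose cycles are its blocks, each block $\{x_1<\dots<x_k\}$ becoming the cycle $x_1\mapsto x_2\mapsto\dots\mapsto x_k\mapsto x_1$; products like $\alpha^{-1}\beta$ are taken in $S_n$. The transformation $\mathcal F$ sends a sequence $(\kappa_n)_{n\ge1}$ (in a commutative ring) to the sequence $(m_n)_{n\ge1}$ given by the moment-cumulant formula $m_n=\sum_{\sigma\in NC(n)}\prod_{c\in\sigma}\kappa_{|c|}$. *)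

(* Defs.v *)
From HB Require Import structures.
From mathcomp Require Import all_boot all_order all_algebra all_fingroup.
From mathcomp Require Import mpoly.

Set Implicit Arguments.
Unset Strict Implicit.
Unset Printing Implicit Defensive.

Import Order.TTheory GRing.Theory.

Definition noncrossing n (P : {set {set 'I_n}}) : bool :=
  [forall B in P, forall C in P,
   [forall a in B, forall c in B, forall b in C, forall d in C,
     [&& (a < b)%N, (b < c)%N & (c < d)%N] ==> (B == C)]].

Lemma noncrossingP n (P : {set {set 'I_n}}) :
  reflect (forall B C (a b c d : 'I_n), B \in P -> C \in P ->
             a \in B -> c \in B -> b \in C -> d \in C ->
             (a < b)%N -> (b < c)%N -> (c < d)%N -> B = C)
          (noncrossing P).
Proof.
apply: (iffP idP) => [H B C a b c d PB PC aB cB bC dC ab bc cd|H].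
  move/forall_inP/(_ B PB)/forall_inP/(_ C PC)/forall_inP/(_ a aB): H.
  move/forall_inP/(_ c cB)/forall_inP/(_ b bC)/forall_inP/(_ d dC).
  by rewrite ab bc cd => /eqP.
apply/forall_inP => B PB; apply/forall_inP => C PC.
apply/forall_inP => a aB; apply/forall_inP => c cB.
apply/forall_inP => b bC; apply/forall_inP => d dC.
by apply/implyP => /and3P[ab bc cd]; apply/eqP; apply: (H B C a b c d).
Qed.

Record NC (n : nat) := MkNC {
  nc_blocks :> {set {set 'I_n}};
  nc_valid : partition nc_blocks [set: 'I_n] && noncrossing nc_blocks }.

HB.instance Definition _ n := [isSub for @nc_blocks n].
HB.instance Definition _ n := [Finite of NC n by <:].

Section Lattice.
Variable n : nat.
Implicit Types (P : {set {set 'I_n}}) (s t u : NC n) (B C : {set 'I_n}).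

Lemma nc_part s : partition s [set: 'I_n].
Proof. by case/andP: (nc_valid s). Qed.

Lemma nc_nc s : noncrossing s.
Proof. by case/andP: (nc_valid s). Qed.

Lemma nc_triv s : trivIset s.
Proof. by case/and3P: (nc_part s). Qed.

Lemma nc_set0 s : set0 \notin nc_blocks s.
Proof. by case/and3P: (nc_part s). Qed.

Lemma nc_cover s (x : 'I_n) : x \in cover s.
Proof. by case/and3P: (nc_part s) => /eqP-> _ _; rewrite inE. Qed.

Lemma nc_pblock s (x : 'I_n) : pblock s x \in nc_blocks s.
Proof. by rewrite pblock_mem ?nc_cover. Qed.

Lemma nc_mem_pblock s (x : 'I_n) : x \in pblock s x.
Proof. by rewrite mem_pblock nc_cover. Qed.

Lemma nc_eq_block s B C (x : 'I_n) :
  B \in nc_blocks s -> C \in nc_blocks s -> x \in B -> x \in C -> B = C.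
Proof.
by move=> sB sC xB xC; rewrite -(def_pblock (nc_triv s) sB xB)
  (def_pblock (nc_triv s) sC xC).
Qed.

Lemma nc_block_ex s B : B \in nc_blocks s -> exists x, x \in B.
Proof.
by move=> sB; apply/set0Pn; apply: contraNneq (nc_set0 s) => <-.
Qed.

(* Reverse refinement order: the singletons are at the bottom. *)
Definition nc_le s t : bool := [forall B in s, exists C in t, B \subset C].

Lemma nc_leP s t :
  reflect (forall B, B \in nc_blocks s ->
             exists2 C, C \in nc_blocks t & B \subset C) (nc_le s t).
Proof.
apply: (iffP forall_inP) => H B sB; first exact/exists_inP/H.
exact/exists_inP/H.
Qed.

Fact nc_le_refl : reflexive nc_le.
Proof. by move=> s; apply/nc_leP => B sB; exists B. Qed.

Fact nc_le_sub s t : nc_le s t -> nc_le t s -> nc_blocks s \subset nc_blocks t.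
Proof.
move=> /nc_leP st /nc_leP ts; apply/subsetP => B sB.
have [C tC BC] := st _ sB; have [D sD CD] := ts _ tC.
have [x xB] := nc_block_ex sB.
have eBD : B = D.
  by apply: (nc_eq_block sB sD xB); apply: (subsetP CD); apply: (subsetP BC).
suff -> : B = C by [].
by apply/eqP; rewrite eqEsubset BC eBD.
Qed.

Fact nc_le_anti : antisymmetric nc_le.
Proof.
move=> s t /andP[st ts]; apply: val_inj; apply/eqP.
by rewrite eqEsubset /= !nc_le_sub.
Qed.

Fact nc_le_trans : transitive nc_le.
Proof.
move=> t s u /nc_leP st /nc_leP tu; apply/nc_leP => B /st[C /tu[D uD CD] BC].
by exists D => //; apply: subset_trans CD.
Qed.

Definition nc_meet_blocks s t : {set {set 'I_n}} :=
  [set B :&: C | B in nc_blocks s, C in nc_blocks t] :\ set0.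

Fact nc_meet_valid s t :
  partition (nc_meet_blocks s t) [set: 'I_n] && noncrossing (nc_meet_blocks s t).
Proof.
apply/andP; split.
  apply/and3P; split; last by rewrite !inE eqxx.
    rewrite eqEsubset subsetT; apply/subsetP => x _; apply/bigcupP.
    exists (pblock s x :&: pblock t x); last by rewrite inE !nc_mem_pblock.
    rewrite !inE imset2_f ?nc_pblock ?andbT //.
    by apply/set0Pn; exists x; rewrite inE !nc_mem_pblock.
  apply/trivIsetP => D E /setD1P[_ /imset2P[B C sB tC ->]].
  move=> /setD1P[_ /imset2P[B' C' sB' tC' ->]]; apply: contraNT.
  case/pred0Pn => x /= /andP[/setIP[xB xC] /setIP[xB' xC']].
  by rewrite (nc_eq_block sB sB' xB xB') (nc_eq_block tC tC' xC xC').
apply/noncrossingP => D E a b c d.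
move=> /setD1P[_ /imset2P[B C sB tC ->]] /setD1P[_ /imset2P[B' C' sB' tC' ->]].
move=> /setIP[aB aC] /setIP[cB cC] /setIP[bB' bC'] /setIP[dB' dC'] ab bc cd.
have /noncrossingP/(_ B B' a b c d sB sB' aB cB bB' dB' ab bc cd) -> := nc_nc s.
by have /noncrossingP/(_ C C' a b c d tC tC' aC cC bC' dC' ab bc cd) -> := nc_nc t.
Qed.

Definition nc_meet s t : NC n := MkNC (nc_meet_valid s t).

Fact nc_lexI s t u : nc_le s (nc_meet t u) = nc_le s t && nc_le s u.
Proof.
apply/nc_leP/andP => [H | [/nc_leP st /nc_leP su] B sB].
  split; apply/nc_leP => B /H[D /setD1P[_ /imset2P[C E tC uE ->]]].
    by rewrite subsetI => /andP[BC _]; exists C.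
  by rewrite subsetI => /andP[_ BE]; exists E.
have [C tC BC] := st _ sB; have [E uE BE] := su _ sB.
have [x xB] := nc_block_ex sB.
exists (C :&: E); last by rewrite subsetI BC.
rewrite !inE imset2_f // andbT; apply/set0Pn; exists x.
by rewrite inE (subsetP BC) ?(subsetP BE).
Qed.

Definition nc_bot_blocks : {set {set 'I_n}} := [set [set i] | i : 'I_n].

Fact nc_bot_valid : partition nc_bot_blocks [set: 'I_n] && noncrossing nc_bot_blocks.
Proof.
apply/andP; split.
  apply/and3P; split.
  - rewrite eqEsubset subsetT; apply/subsetP => x _; apply/bigcupP.
    by exists [set x]; rewrite ?imset_f ?inE.
  - apply/trivIsetP => B C /imsetP[x _ ->] /imsetP[y _ ->]; apply: contraNT.
    by case/pred0Pn => z /= /andP[/set1P-> /set1P->].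
  - by apply/imsetP => -[x _ /setP/(_ x)]; rewrite !inE eqxx.
apply/noncrossingP => B C a b c d /imsetP[x _ ->] _ /set1P-> /set1P-> _ _ ab bc.
by have := ltn_trans ab bc; rewrite ltnn.
Qed.

Definition nc_bot : NC n := MkNC nc_bot_valid.

Fact nc_le0x s : nc_le nc_bot s.
Proof.
apply/nc_leP => B /imsetP[x _ ->]; exists (pblock s x); first exact: nc_pblock.
by rewrite sub1set nc_mem_pblock.
Qed.

(* Removing set0 only matters for n = 0. *)
Definition nc_top_blocks : {set {set 'I_n}} := [set [set: 'I_n]] :\ set0.

Fact nc_top_valid : partition nc_top_blocks [set: 'I_n] && noncrossing nc_top_blocks.
Proof.
apply/andP; split.
  apply/and3P; split; last by rewrite !inE eqxx.
    rewrite eqEsubset subsetT; apply/subsetP => x _; apply/bigcupP.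
    by exists setT; rewrite !inE // eqxx andbT; apply/set0Pn; exists x.
  by apply/trivIsetP => B C /setD1P[_ /set1P->] /setD1P[_ /set1P->]; rewrite eqxx.
by apply/noncrossingP => B C a b c d /setD1P[_ /set1P->] /setD1P[_ /set1P->].
Qed.

Definition nc_top : NC n := MkNC nc_top_valid.

Fact nc_lex1 s : nc_le s nc_top.
Proof.
apply/nc_leP => B sB; exists setT => //; have [x _] := nc_block_ex sB.
by rewrite !inE eqxx andbT; apply/set0Pn; exists x.
Qed.

End Lattice.

Fact nc_display : Order.disp_t. Proof. exact: Order.Disp tt tt. Qed.

HB.instance Definition _ n := Order.Le_isPOrder.Build nc_display (NC n)
  (@nc_le_refl n) (@nc_le_anti n) (@nc_le_trans n).
HB.instance Definition _ n :=
  Order.POrder_isMeetSemilattice.Build nc_display (NC n) (@nc_lexI n).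
HB.instance Definition _ n :=
  Order.hasBottom.Build nc_display (NC n) (@nc_le0x n).
HB.instance Definition _ n :=
  Order.hasTop.Build nc_display (NC n) (@nc_lex1 n).

(* The join of NC(n) is the least non-crossing common coarsening; in general it
   is strictly coarser than the join in the lattice of all set partitions. *)
Definition nc_join n (s t : NC n) : NC n :=
  (\meet_(u : NC n | (s <= u) && (t <= u)) u)%O.

Fact nc_leUx n (s t u : NC n) : (nc_join s t <= u)%O = (s <= u)%O && (t <= u)%O.
Proof.
apply/idP/andP => [le_u | [su tu]].
  by split; apply: le_trans le_u; apply/meetsP => v /andP[].
by apply: meets_inf; rewrite su.
Qed.

HB.instance Definition _ n :=
  Order.POrder_isJoinSemilattice.Build nc_display (NC n) (@nc_leUx n).

Definition nc_fun n (s : NC n) (x : 'I_n) : 'I_n := next (enum (pblock s x)) x.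

Lemma nc_fun_inj n (s : NC n) : injective (@nc_fun n s).
Proof.
have pbl x : pblock s (nc_fun s x) = pblock s x.
  apply: (def_pblock (nc_triv s) (nc_pblock s x)).
  by rewrite -mem_enum mem_next mem_enum nc_mem_pblock.
move=> x y e; have exy : pblock s x = pblock s y by rewrite -pbl e pbl.
apply: (can_inj (prev_next (enum_uniq (mem (pblock s x))))).
by move: e; rewrite /nc_fun -exy.
Qed.

(* [enum] lists a block in increasing order, so [next] is x_1 -> ... -> x_k -> x_1. *)
Definition nc_perm n (s : NC n) : 'S_n := perm (@nc_fun_inj n s).

Definition prod_of_transp (T : finType) (s : {perm T}) (k : nat) : bool :=
  [exists t : k.-tuple (T * T),
     all dpair t && (s == \prod_(p <- t) tperm p.1 p.2)%g].

Lemma prod_of_transp_ex (T : finType) (s : {perm T}) :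
  exists k, prod_of_transp s k.
Proof.
have [ts defs dts] := prod_tpermP s; exists (size ts); apply/existsP.
by exists (in_tuple ts); rewrite /= dts defs eqxx.
Qed.

Definition perm_length (T : finType) (s : {perm T}) : nat :=
  ex_minn (prod_of_transp_ex s).

Lemma card_porbits1 (T : finType) : #|porbits (1 : {perm T})| = #|T|.
Proof.
rewrite card_imset // => x y /setP/(_ x).
by rewrite porbit_id => /esym/porbitP[i ->]; rewrite expg1n perm1.
Qed.

Lemma card_porbits_prod_tperm (T : finType) (ts : seq (T * T)) :
  (#|T| <= #|porbits (\prod_(p <- ts) tperm p.1 p.2)%g| + size ts)%N.
Proof.
elim: ts => [|[x y] ts IH]; first by rewrite big_nil card_porbits1 addn0.
rewrite big_cons /= (leq_trans IH) // addnS -addSn leq_add2r.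
set s := (\prod_(_ <- ts) _)%g; have /= := porbits_mul_tperm s x y.
case: (eqVneq x y) => [->|_]; first by rewrite porbit_id addn0 => ->; rewrite addn0.
case: (x \notin _) => /=; rewrite ?addn0 => e.
  by move/eqP: e; rewrite addn2 addn1 eqSS => /eqP <-.
by rewrite e addn1 leqW.
Qed.

Lemma prod_tperm_card_porbits (T : finType) (s : {perm T}) :
  exists ts : seq (T * T),
    [/\ all dpair ts, s = (\prod_(p <- ts) tperm p.1 p.2)%g &
        size ts = (#|T| - #|porbits s|)%N].
Proof.
have [m] := ubnP (#|T| - #|porbits s|)%N; elim: m s => // m IHm s /ltnSE-le_s_m.
case: (pickP (fun x => s x != x)) => [x s_x | s_id]; last first.
  have -> : s = 1%g.
    by apply/permP => x; rewrite perm1; apply/eqP/negbFE/s_id.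
  by exists nil; rewrite big_nil card_porbits1 subnn.
pose s' := (tperm x (s x) * s)%g.
have cs' : #|porbits s'| = #|porbits s|.+1.
  have := porbits_mul_tperm s x (s x).
  by rewrite porbit_sym (mem_porbit s 1) /= addn0 eq_sym s_x addn1.
have le_s' : (#|porbits s'| <= #|T|)%N by rewrite leq_imset_card.
rewrite cs' in le_s'.
have es : (#|T| - #|porbits s|)%N = (#|T| - #|porbits s'|).+1.
  by rewrite cs' -subSn // subSS.
have [|ts [dts es' sz]] := IHm s'; first by rewrite -es in le_s_m *.
exists ((x, s x) :: ts); split => /=; first by rewrite eq_sym s_x.
  by rewrite big_cons -es' /s' mulgA tperm2 mul1g.
by rewrite sz es.
Qed.

Lemma perm_lengthE (T : finType) (s : {perm T}) :
  perm_length s = (#|T| - #|porbits s|)%N.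
Proof.
rewrite /perm_length; case: ex_minnP => k /existsP[t /andP[dt /eqP es]] mink.
have [ts [dts es' sz]] := prod_tperm_card_porbits s.
apply/eqP; rewrite eqn_leq -{1}sz mink /=; last first.
  by apply/existsP; exists (in_tuple ts); rewrite /= dts -es' eqxx.
by rewrite leq_subLR {1}es -{2}(size_tuple t) card_porbits_prod_tperm.
Qed.

(* Hence the natural-number subtractions in [f_poly] are exact for n > 0. *)
Lemma perm_length_ltn n (s : 'S_n.+1) : (perm_length s <= n)%N.
Proof.
have : (0 < #|porbits s|)%N.
  by rewrite card_gt0; apply/set0Pn; exists (porbit s ord0); apply: imset_f.
by rewrite perm_lengthE card_ord leq_subLR -(leq_add2r n) add1n.
Qed.

Local Open Scope ring_scope.

(* Sequences are indexed by n >= 1: the values at 0 are irrelevant. *)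
Definition nc_transform (R : comPzRingType) (kappa : nat -> R) (n : nat) : R :=
  \sum_(s : NC n) \prod_(c in nc_blocks s) kappa #|c|.

Definition Yvar : {mpoly int[3]} := 'X_(0 : 'I_3).
Definition Avar : {mpoly int[3]} := 'X_(1 : 'I_3).
Definition Bvar : {mpoly int[3]} := 'X_(2 : 'I_3).

(* The product of 'S_n composes from left to right; with the opposite convention
   s^-1 * t becomes t * s^-1, a conjugate, which has the same length. *)
Definition nc_dist n (s t : NC n) : nat :=
  perm_length ((nc_perm s)^-1 * nc_perm t)%g.

Definition nc_length n (s : NC n) : nat := perm_length (nc_perm s).

Definition e_poly (n : nat) : {mpoly int[3]} :=
  \sum_(s : NC n) \sum_(t : NC n |
      ((s `&` t)%O == \bot%O) && ((s `|` t)%O == \top%O))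
    Yvar ^+ nc_dist s t * Avar ^+ nc_length s * Bvar ^+ nc_length t.

Definition f_poly (n : nat) : {mpoly int[3]} :=
  \sum_(s : NC n) \sum_(t : NC n | (s `|` t)%O == \top%O)
    Yvar ^+ nc_dist s t *
    Avar ^+ (n.-1 - nc_length s) * Bvar ^+ (n.-1 - nc_length t).

Definition g_poly (n : nat) : {mpoly int[3]} :=
  \sum_(s : NC n) \sum_(t : NC n)
    Yvar ^+ nc_dist s t *
    Avar ^+ nc_dist s (s `|` t)%O * Bvar ^+ nc_dist t (s `|` t)%O.

(* Main.v *)
(* Both identities come from the isomorphism of [0, sigma] with the product of the
   NC(|c|) over the blocks c of sigma: summing over the pairs (alpha, beta) with
   alpha \/ beta = sigma, all the lengths add up over the blocks. For g_n this is the
   whole proof. For f_n the Kreweras complement alpha |-> alpha^-1 (1 2 ... n), an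
   anti-automorphism of NC(n) preserving the distance |alpha^-1 beta|, first turns the
   condition alpha \/ beta = 1_n into alpha /\ beta = 0_n and n - 1 - |alpha| into
   |alpha|.

   The Kreweras complement rests on two facts. If s <= t in NC(n), then
   |s^-1 t| + |s| = |t|; conversely every permutation p on a geodesic from the
   identity to t, i.e. with |p| + |p^-1 t| = |t|, comes from a non-crossing partition
   s <= t. Both are proved by moving t one step down: for x with p x <> t x, the
   product of t with the transposition (p x, t x) cuts the block of t containing x
   into an interval of this block and its complement, which is again non-crossing. *)
Require Import Defs.
From mathcomp Require Import all_boot all_order all_algebra all_fingroup.
From mathcomp Require Import mpoly zify.

Set Implicit Arguments.
Unset Strict Implicit.
Unset Printing Implicit Defensive.

Import Order.TTheory GRing.Theory.

(** * Non-crossing partitions as relations *)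

(** In terms of this relation the order becomes implication, the meet conjunction, and non-crossing
    a condition on four points. *)
Definition nc_rel n (s : NC n) : rel 'I_n := fun x y => y \in pblock s x.

Section Rel.
Variable n : nat.
Implicit Types (s t : NC n) (x y z : 'I_n) (B : {set 'I_n}).

Lemma nc_rel_refl s x : nc_rel s x x.
Proof. exact: nc_mem_pblock. Qed.

Lemma nc_rel_pblock s x y : nc_rel s x y -> pblock s y = pblock s x.
Proof. by move=> ?; apply/(def_pblock (nc_triv s)); rewrite ?nc_pblock. Qed.

Lemma nc_rel_sym s x y : nc_rel s x y = nc_rel s y x.
Proof.
suff sub a b : nc_rel s a b -> nc_rel s b a by apply/idP/idP; apply: sub.
by move/nc_rel_pblock => e; rewrite /nc_rel e nc_mem_pblock.
Qed.

Lemma nc_rel_trans s : transitive (nc_rel s).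
Proof. by move=> y x z /nc_rel_pblock; rewrite /nc_rel => ->. Qed.

Lemma nc_relE s B x y : B \in nc_blocks s -> x \in B -> nc_rel s x y = (y \in B).
Proof. by move=> sB xB; rewrite /nc_rel (def_pblock (nc_triv s) sB xB). Qed.

Lemma nc_rel_cross s (a b c d : 'I_n) :
  a < b -> b < c -> c < d -> nc_rel s a c -> nc_rel s b d -> nc_rel s a b.
Proof.
move=> ab bc cd ac bd; rewrite /nc_rel.
have /noncrossingP/(_ _ _ a b c d (nc_pblock s a) (nc_pblock s b)) -> // := nc_nc s;
exact: nc_mem_pblock.
Qed.

Lemma nc_le_rel s t :
  reflect (forall x y, nc_rel s x y -> nc_rel t x y) (s <= t)%O.
Proof.
apply: (iffP (nc_leP _ _)) => [st x y xy | st B sB].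
  have [C tC /subsetP BC] := st _ (nc_pblock s x).
  by rewrite (nc_relE _ tC) BC // nc_mem_pblock.
have [x xB] := nc_block_ex sB; exists (pblock t x); first exact: nc_pblock.
by apply/subsetP => y; rewrite -(nc_relE y sB xB) => /st.
Qed.

Lemma nc_rel_inj s t : (forall x y, nc_rel s x y = nc_rel t x y) -> s = t.
Proof.
by move=> e; apply/le_anti/andP; split; apply/nc_le_rel => x y; rewrite e.
Qed.

Lemma nc_rel_meet s t x y : nc_rel (s `&` t)%O x y = nc_rel s x y && nc_rel t x y.
Proof.
rewrite (@nc_relE _ (pblock s x :&: pblock t x)) ?inE ?nc_mem_pblock //.
rewrite imset2_f ?nc_pblock // andbT.
by apply/set0Pn; exists x; rewrite inE !nc_mem_pblock.
Qed.

Lemma nc_rel_bot x y : nc_rel \bot%O x y = (x == y).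
Proof. by rewrite (@nc_relE _ [set x]) ?inE ?imset_f // eq_sym. Qed.

Lemma nc_rel_top x y : nc_rel \top%O x y.
Proof.
rewrite (@nc_relE _ setT) ?inE // eqxx andbT.
by apply/set0Pn; exists x; rewrite inE.
Qed.

(** * Non-crossing partitions given by equivalence relations *)

Section OfRel.
Variable R : rel 'I_n.
Hypotheses (Rrefl : reflexive R) (Rsym : ssrbool.symmetric R) (Rtrans : transitive R).
Hypothesis Rcross : forall a b c d : 'I_n,
  a < b -> b < c -> c < d -> R a c -> R b d -> R a b.

Let eqR : {in [set: 'I_n] & &, equivalence_rel R}.
Proof.
move=> x y z _ _ _; split=> // xy.
by apply/idP/idP; apply: Rtrans; rewrite // Rsym.
Qed.

Fact nc_of_rel_valid :
  partition (equivalence_partition R [set: 'I_n]) [set: 'I_n] &&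
  noncrossing (equivalence_partition R [set: 'I_n]).
Proof.
rewrite equivalence_partitionP //=; apply/noncrossingP => B C a b c d.
move=> /imsetP[x _ ->] /imsetP[y _ ->]; rewrite !inE /= => xa xc yb yd ab bc cd.
have ac : R a c by rewrite (Rtrans _ xc) // Rsym.
have bd : R b d by rewrite (Rtrans _ yd) // Rsym.
have xy : R x y.
  by apply: Rtrans xa (Rtrans (Rcross ab bc cd ac bd) _); rewrite Rsym.
by apply/setP => z; rewrite !inE /=; apply/idP/idP; apply: Rtrans; rewrite // Rsym.
Qed.

Definition nc_of_rel : NC n := MkNC nc_of_rel_valid.

Lemma nc_of_relE x y : nc_rel nc_of_rel x y = R x y.
Proof. by rewrite /nc_rel pblock_equivalence_partition. Qed.

End OfRel.

(* In the second case [x] is the maximum and [y] the minimum of [B]. *)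
Definition cyclic_next B x y :=
  y \in B /\ (x < y /\ (forall z, z \in B -> (z <= x) || (y <= z)) \/
              y <= x /\ (forall z, z \in B -> y <= z <= x)).

(** With [cyclic_nextP] this characterizes [nc_perm] by inequalities alone, so that later arguments
    can end in linear arithmetic. *)
Lemma cyclic_next_uniq B x y z : cyclic_next B x y -> cyclic_next B x z -> y = z.
Proof.
move=> [yB Hy] [zB Hz]; apply: val_inj => /=.
case: Hy => -[xy /(_ _ zB) Hy]; case: Hz => -[xz /(_ _ yB) Hz]; lia.
Qed.


Lemma sorted_enum_ord (A : {set 'I_n}) : sorted ltn (map val (enum A)).
Proof.
rewrite -[enum _](eq_filter (mem_enum _)).
rewrite -(eq_filter (mem_map val_inj _)) -filter_map.
by rewrite (sorted_filter ltn_trans) // unlock val_ord_enum iota_ltn_sorted.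
Qed.

(** The index in the enumeration is an increasing bijection from [B] onto the integers below [#|B|],
    where the successor is addition of 1 modulo [#|B|]. *)
Lemma cyclic_nextP B x : x \in B -> cyclic_next B x (next (enum B) x).
Proof.
move=> xB; pose i z := index z (enum B).
have idx z : z \in B -> i z < #|B| by move=> zB; rewrite cardE index_mem mem_enum.
have nthK z : z \in B -> nth x (enum B) (i z) = z.
  by move=> zB; rewrite nth_index // mem_enum.
have ltE y z : y \in B -> z \in B -> (y < z) = (i y < i z).
  suff ltW a b : a \in B -> b \in B -> i a < i b -> a < b.
    move=> yB zB; case: (ltngtP (i y) (i z)) => [|/ltW zy|]; first exact: ltW.
      by apply/negbTE; rewrite -leqNgt ltnW ?zy.
    by move=> eq_i; rewrite -(nthK y yB) eq_i nthK // ltnn.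
  move=> aB bB ab; rewrite -(nthK a aB) -(nthK b bB).
  rewrite -!(nth_map x (val x) val) -?cardE ?idx //.
  by apply: (sorted_ltn_nth ltn_trans) => //;
    rewrite ?sorted_enum_ord ?inE ?size_map -?cardE ?idx.
have leE y z : y \in B -> z \in B -> (y <= z) = (i y <= i z).
  by move=> yB zB; rewrite leqNgt ltE // -leqNgt.
have nextB : next (enum B) x \in B by rewrite -mem_enum mem_next mem_enum.
have nextE : i (next (enum B) x) = if (i x).+1 < #|B| then (i x).+1 else 0.
  have xE : x \in enum B by rewrite mem_enum.
  have := xE; have := enum_uniq B; rewrite next_nth xE cardE /i.
  case: (enum B) => // y p Up _.
  (* [next] reads the tail [p] with the head [y] as default value; this default sends the last
     element back to the first. *)
  have -> : nth y p (index x (y :: p)) =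
            nth y (y :: p) (if (index x (y :: p)).+1 < size (y :: p)
                            then (index x (y :: p)).+1 else 0).
    by rewrite [size _]/= ltnS; case: ltnP => // ?; rewrite nth_default.
  by rewrite index_uniq //; case: ifP.
split=> //; have := idx x xB; move: nextE; case: ifP => [i1 nextE | i1 nextE] ix.
  left; split=> [|z zB]; first by rewrite ltE // nextE.
  by rewrite !leE // nextE; lia.
right; split=> [|z zB]; first by rewrite leE // nextE; lia.
by rewrite !leE // nextE; have := idx z zB; lia.
Qed.

Lemma nc_permE s x : nc_perm s x = next (enum (pblock s x)) x.
Proof. by rewrite permE. Qed.

Lemma nc_permP s x : cyclic_next (pblock s x) x (nc_perm s x).
Proof. by rewrite nc_permE; apply/cyclic_nextP/nc_mem_pblock. Qed.

Lemma nc_perm_uniq s x y : cyclic_next (pblock s x) x y -> nc_perm s x = y.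
Proof. exact: (cyclic_next_uniq (nc_permP s x)). Qed.

Lemma nc_rel_perm s x : nc_rel s x (nc_perm s x).
Proof. by case: (nc_permP s x). Qed.

(** On a block [nc_perm s] agrees with [next], so the enumeration of the block is a cycle of it. *)
Lemma porbit_nc_perm s x : porbit (nc_perm s) x = pblock s x.
Proof.
have cyc : fcycle (nc_perm s) (enum (pblock s x)).
  have sub : {in pblock s x &,
      subrel (frel (next (enum (pblock s x)))) (frel (nc_perm s))}.
    by move=> y z yB _ /= /eqP<-; rewrite nc_permE (nc_rel_pblock yB).
  apply: (sub_in_cycle sub) (cycle_next (enum_uniq _)).
  by apply/allP => y; rewrite mem_enum.
apply/setP => y; rewrite -[RHS]mem_enum -(fconnect_cycle cyc (x := x)) ?mem_enum ?nc_mem_pblock //.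
apply/porbitP/idP => [[i ->]|/iter_findex <-]; first by rewrite permX fconnect_iter.
by exists (findex (nc_perm s) x y); rewrite permX.
Qed.
End Rel.

(** * Splitting a block *)

Lemma nc_perm_inj n : injective (@nc_perm n).
Proof.
by move=> s t e; apply: nc_rel_inj => x y; rewrite /nc_rel -!porbit_nc_perm e.
Qed.

Section Split.
Variables (n : nat) (s : NC n) (u v : 'I_n).
Hypotheses (uv : u < v) (suv : nc_rel s u v).

(** The interval is half-open, so that [u] and [v] fall on different sides. An interval of a block
    never crosses the rest of that block. *)
Let inI z := nc_rel s u z && (u <= z < v).
Let R x y := nc_rel s x y && (inI x == inI y).

Let Rrefl : reflexive R. Proof. by move=> x; rewrite /R nc_rel_refl eqxx. Qed.
Let Rsym : ssrbool.symmetric R.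
Proof. by move=> x y; rewrite /R nc_rel_sym eq_sym. Qed.
Let Rtrans : transitive R.
Proof.
move=> y x z /andP[xy /eqP exy] /andP[yz /eqP eyz].
by rewrite /R (nc_rel_trans xy yz) exy eyz eqxx.
Qed.
Let Rcross (a b c d : 'I_n) :
  a < b -> b < c -> c < d -> R a c -> R b d -> R a b.
Proof.
move=> ab bc cd /andP[ac /eqP eac] /andP[bd /eqP ebd].
have sab := nc_rel_cross ab bc cd ac bd; rewrite /R sab /=.
move: eac ebd; rewrite /inI.
have rel_u z : nc_rel s a z -> nc_rel s u z = nc_rel s u a.
  move=> az; apply/idP/idP => uz; apply: nc_rel_trans uz _ => //.
  by rewrite nc_rel_sym.
rewrite (rel_u b) // (rel_u c) // (rel_u d) ?(nc_rel_trans sab) //.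
by case: (nc_rel s u a) => //=; lia.
Qed.

Definition nc_split : NC n := nc_of_rel Rrefl Rsym Rtrans Rcross.

Lemma nc_rel_split x y : nc_rel nc_split x y =
  nc_rel s x y && ((nc_rel s u x && (u <= x < v)) == (nc_rel s u y && (u <= y < v))).
Proof. exact: nc_of_relE. Qed.

Lemma nc_split_le : (nc_split <= s)%O.
Proof. by apply/nc_le_rel => x y; rewrite nc_rel_split => /andP[]. Qed.

(** Products act from left to right, so the transposition exchanges the values [u] and [v]: the last
    point before [v] returns to [u], closing the interval, and the predecessor of [u] jumps over it
    to [v]. *)
Lemma nc_perm_split : nc_perm nc_split = (nc_perm s * tperm u v)%g.
Proof.
apply/permP => x; rewrite permM; apply: nc_perm_uniq.
have [xB Hx] := nc_permP s x; have xx : nc_rel s x (nc_perm s x) := xB.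
set y := nc_perm s x in xB Hx xx *.
rewrite /cyclic_next -/(nc_rel _ _ _) nc_rel_split.
have memS z : (z \in pblock nc_split x) =
  nc_rel s x z && ((nc_rel s u x && (u <= x < v)) == (nc_rel s u z && (u <= z < v))).
  exact: nc_rel_split.
have sv : nc_rel s v u by rewrite nc_rel_sym.
have rel_u z : nc_rel s x z -> nc_rel s u z = nc_rel s u x.
  move=> xz; apply/idP/idP => uz; apply: nc_rel_trans uz _ => //.
  by rewrite nc_rel_sym.
have [ux | ux] := boolP (nc_rel s u x); last first.
  have yu : y != u.
    by apply: contraNneq ux => <-; rewrite nc_rel_sym.
  have yv : y != v.
    by apply: contraNneq ux => ev; apply: (nc_rel_trans suv); rewrite -ev nc_rel_sym.
  rewrite tpermD 1?eq_sym // xx rel_u // (negPf ux); split=> //.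
  by case: Hx => -[xy Hz]; [left|right]; split=> // z; rewrite memS => /andP[xz _];
    apply: Hz.
have xu : nc_rel s x u by rewrite nc_rel_sym.
have xv : nc_rel s x v := nc_rel_trans xu suv.
have {}memS z : (z \in pblock nc_split x) =
   nc_rel s x z && ((u <= x < v) == (u <= z < v)).
  rewrite memS ux /=; case xz: (nc_rel s x z) => //=.
  by rewrite (rel_u _ xz) ux.
have Hx' : x < y /\ (forall z : 'I_n, nc_rel s x z -> (z <= x) || (y <= z)) \/
   y <= x /\ (forall z : 'I_n, nc_rel s x z -> y <= z <= x) by [].
have Hu : y = u \/ (y != u :> nat) by case: (eqVneq y u); [left|right].
have Hv : y = v \/ (y != v :> nat) by case: (eqVneq y v); [left|right].
(* Here [x] precedes [u] in the block, so it lies outside the interval and its new successor is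
   [v]. *)
case: Hu => [yu|yu].
  rewrite yu tpermL in Hx' *.
  rewrite xv (rel_u v) // ux /=.
  have Hv' : (v <= x) || (x < u).
    by case: Hx' => -[xy Hz]; have := Hz _ xv; lia.
  split; first lia.
  case: Hx' => -[xy Hz].
    left; split; first lia; move=> z; rewrite memS => /andP[/Hz]; lia.
  right; split; first lia; move=> z; rewrite memS => /andP[/Hz]; lia.
(* Here [x] is the maximum of the interval, and its new successor is the minimum [u]. *)
case: Hv => [yv|yv].
  rewrite yv tpermR in Hx' *.
  rewrite xu (rel_u u) // ux /=.
  have Hv' : (u <= x < v).
    by case: Hx' => -[xy Hz]; have := Hz _ xu; lia.
  split; first lia.
  right; split; first lia; move=> z; rewrite memS => /andP[xz].
  by case: Hx' => -[xy /(_ z xz)]; lia.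
rewrite tpermD; first last.
- by rewrite -(inj_eq val_inj) /= eq_sym.
- by rewrite -(inj_eq val_inj) /= eq_sym.
rewrite xx (rel_u y) // ux /=; split.
  by case: Hx' => -[xy Hz]; have := Hz _ xu; have := Hz _ xv; lia.
by case: Hx' => -[xy Hz]; [left|right]; split=> // z; rewrite memS => /andP[/Hz]; lia.
Qed.

End Split.

(** * Length of permutations: triangle inequality, conjugation, effect of a transposition *)

Section PermLength.
Variable T : finType.
Implicit Types (s t : {perm T}) (x y : T).

Lemma leq_card_porbits s : #|porbits s| <= #|T|.
Proof. exact: leq_imset_card. Qed.

Lemma perm_length1 : perm_length (1 : {perm T}) = 0.
Proof. by rewrite perm_lengthE card_porbits1 subnn. Qed.

Lemma perm_lengthV s : perm_length s^-1 = perm_length s.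
Proof. by rewrite !perm_lengthE porbitsV. Qed.

Lemma perm_length_prod (ts : seq (T * T)) :
  perm_length (\prod_(p <- ts) tperm p.1 p.2)%g <= size ts.
Proof. by rewrite perm_lengthE leq_subLR card_porbits_prod_tperm. Qed.

Lemma perm_length_ex s : exists2 ts : seq (T * T),
  s = (\prod_(p <- ts) tperm p.1 p.2)%g & size ts = perm_length s.
Proof.
by have [ts [_ es sz]] := prod_tperm_card_porbits s; exists ts; rewrite // perm_lengthE.
Qed.

Lemma perm_lengthM s t : perm_length (s * t) <= perm_length s + perm_length t.
Proof.
have [us -> <-] := perm_length_ex s; have [vs -> <-] := perm_length_ex t.
by rewrite -big_cat -size_cat perm_length_prod.
Qed.

Lemma perm_lengthJ s t : perm_length (s ^ t) = perm_length s.
Proof.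
suff le (a b : {perm T}) : perm_length (a ^ b) <= perm_length a.
  by apply/eqP; rewrite eqn_leq le /= -{1}(conjgK t s) le.
have [ts -> <-] := perm_length_ex a; rewrite -(size_map (fun p : T * T => (b p.1, b p.2)) ts).
suff -> : ((\prod_(p <- ts) tperm p.1 p.2) ^ b =
  \prod_(p <- [seq (b p.1, b p.2) | p <- ts]) tperm p.1 p.2)%g by exact: perm_length_prod.
elim: ts => [|[x y] ts IH] /=; first by rewrite !big_nil conj1g.
by rewrite !big_cons conjMg IH /= tpermJ.
Qed.

Lemma perm_length_split s x y : x != y -> y \in porbit s x ->
  (perm_length (s * tperm x y)).+1 = perm_length s.
Proof.
(* [porbits_mul_tperm] multiplies by the transposition on the left, hence the passage to
   inverses. *)
move=> xy xsy; rewrite -[perm_length (_ * _)]perm_lengthV -[RHS]perm_lengthV.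
have := porbits_mul_tperm s^-1 x y; rewrite invMg tpermV !perm_lengthE /=.
rewrite porbitV porbit_sym xsy xy addn0.
have := leq_card_porbits (tperm x y * s^-1); rewrite /=.
by move: #|porbits (tperm x y * s^-1)| #|porbits s^-1| => p q; lia.
Qed.

Lemma perm_length_merge s x y : y \notin porbit s x ->
  perm_length (s * tperm x y) = (perm_length s).+1.
Proof.
move=> xsy; rewrite -[perm_length (_ * _)]perm_lengthV -[in RHS]perm_lengthV.
have := porbits_mul_tperm s^-1 x y; rewrite invMg tpermV !perm_lengthE /=.
have -> : x != y by apply: contraNneq xsy => ->; apply: porbit_id.
rewrite porbitV porbit_sym xsy.
have := leq_card_porbits s^-1; rewrite /=.
by move: #|porbits (tperm x y * s^-1)| #|porbits s^-1| => p q; lia.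
Qed.

End PermLength.

Lemma nc_perm_split_ex n (s : NC n) u v : u != v -> nc_rel s u v ->
  exists2 t, (t <= s)%O & nc_perm t = (nc_perm s * tperm u v)%g.
Proof.
rewrite -(inj_eq val_inj) neq_ltn => /orP[uv suv | vu].
  by exists (nc_split uv suv); rewrite ?nc_split_le ?nc_perm_split.
rewrite nc_rel_sym => svu; exists (nc_split vu svu); first exact: nc_split_le.
by rewrite nc_perm_split tpermC.
Qed.

(* The two halves of the split block are cut at the two successors of [x], and no
   block of [s] crosses this cut. *)
Lemma nc_interpolate n (s t : NC n) x :
  (s <= t)%O -> nc_perm s x != nc_perm t x ->
  exists r, [/\ (s <= r)%O, (r <= t)%O &
    nc_perm r = (nc_perm t * tperm (nc_perm s x) (nc_perm t x))%g].
Proof.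
move=> /nc_le_rel st; set a := nc_perm s x; set b := nc_perm t x => ab.
have xa : nc_rel s x a := nc_rel_perm s x; have xb : nc_rel t x b := nc_rel_perm t x.
have txa := st _ _ xa.
have tab : nc_rel t a b by apply: nc_rel_trans xb; rewrite nc_rel_sym.
have [_ Ha] := nc_permP s x; rewrite -/a in Ha.
have [_ Hb] := nc_permP t x; rewrite -/b in Hb.
have Ha' : x < a /\ (forall z : 'I_n, nc_rel s x z -> (z <= x) || (a <= z)) \/
   a <= x /\ (forall z : 'I_n, nc_rel s x z -> a <= z <= x) by [].
have Hb' : x < b /\ (forall z : 'I_n, nc_rel t x z -> (z <= x) || (b <= z)) \/
   b <= x /\ (forall z : 'I_n, nc_rel t x z -> b <= z <= x) by [].
have nat_ab : a != b :> nat by rewrite (inj_eq val_inj).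
have cross : forall z w : 'I_n, nc_rel s z w -> nc_rel t x z -> nc_rel t x w ->
   (minn a b <= z < maxn a b) -> (minn a b <= w < maxn a b).
  move=> z w zw xz xw.
  have wz : nc_rel s w z by rewrite nc_rel_sym.
  have ax : nc_rel s a x by rewrite nc_rel_sym.
  have relz p : nc_rel s z p = nc_rel s w p.
    by apply/idP/idP; apply: nc_rel_trans.
  have relx p : nc_rel s p a = nc_rel s p x.
    by apply/idP/idP => pr; [apply: nc_rel_trans ax | apply: nc_rel_trans xa].
  (* The block of [x] in [s] avoids the cyclic arc from [b] to just before [a], so it lies entirely
     inside or entirely outside the interval. *)
  have [sxz|sxz] := boolP (nc_rel s x z).
    have sxw := nc_rel_trans sxz zw.
    case: Ha' => -[xa' Haz]; move: {Haz} (Haz _ sxz) (Haz _ sxw) (Haz _ xa) xa';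
    case: Hb' => -[xb' Hbz]; move: {Hbz} (Hbz _ xz) (Hbz _ xw) (Hbz _ txa) xb';
    move: nat_ab; clear;
    move: (nat_of_ord a) (nat_of_ord b) (nat_of_ord x) (nat_of_ord z) (nat_of_ord w) => *; lia.
  have nz p : nc_rel s x p -> z != p :> nat.
    by move=> xp; apply: contraNneq sxz => /val_inj->.
  have nw p : nc_rel s x p -> w != p :> nat.
    move=> xp; apply: contraNneq sxz => /val_inj ew.
    by apply: nc_rel_trans wz; rewrite ew.
  have zx := nz _ (nc_rel_refl s x); have wx := nw _ (nc_rel_refl s x).
  have za := nz _ xa; have wa := nw _ xa.
  have szx : nc_rel s z x = false by apply/negbTE; rewrite nc_rel_sym.
  (* [C1] to [C5] exclude orders in which the pairs [z], [w] and [x], [a] cross. No point of the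
     block of [t] lies strictly between [x] and its successor [b], so cutting at [x] and [a] amounts
     to cutting at [b] and [a]. *)
  have C1 : ~ (w < x /\ x < z /\ z < a).
    by case=> wx' [xz' za']; have := nc_rel_cross wx' xz' za' wz xa; rewrite -relz szx.
  have C2 : ~ (x < z /\ z < a /\ a < w).
    by case=> xz' [za' aw]; have := nc_rel_cross xz' za' aw xa zw; rewrite (negPf sxz).
  have C3 : ~ (z < a /\ a < w /\ w < x).
    by case=> za' [aw wx']; have := nc_rel_cross za' aw wx' zw ax; rewrite relx szx.
  have C4 : ~ (w < a /\ a < z /\ z < x).
    by case=> wa' [az zx']; have := nc_rel_cross wa' az zx' wz ax; rewrite relx -relz szx.
  have C5 : ~ (a < z /\ z < x /\ x < w).
    by case=> az [zx' xw']; have := nc_rel_cross az zx' xw' ax zw; rewrite nc_rel_sym relx szx.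
  move: C1 C2 C3 C4 C5 zx wx za wa nat_ab.
  case: Ha' => -[xa' _]; case: Hb' => -[xb' Hbz];
  move: xa' xb' (Hbz _ xz) (Hbz _ xw) (Hbz _ txa); clear;
  move: (nat_of_ord a) (nat_of_ord b) (nat_of_ord x) (nat_of_ord z) (nat_of_ord w) => *; lia.
have le_split (u v : 'I_n) (uv : u < v) (tuv : nc_rel t u v) :
    minn a b = u -> maxn a b = v -> nc_rel t x u -> (s <= nc_split uv tuv)%O.
  move=> eu ev xu; rewrite eu ev in cross; apply/nc_le_rel => z w zw.
  rewrite nc_rel_split st //=.
  have xrel p : nc_rel t u p = nc_rel t x p.
    apply/idP/idP; first exact: nc_rel_trans.
    by apply: nc_rel_trans; rewrite nc_rel_sym.
  have tzw := st _ _ zw; have twz : nc_rel t w z by rewrite nc_rel_sym.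
  have wz : nc_rel s w z by rewrite nc_rel_sym.
  rewrite !xrel; have [xz|xz] := boolP (nc_rel t x z).
    have xw := nc_rel_trans xz tzw.
    by rewrite xw /=; apply/eqP; apply/idP/idP; [apply: cross zw _ _ | apply: cross wz _ _].
  by case: (boolP (nc_rel t x w)) => // xw; rewrite (nc_rel_trans xw twz) in xz.
case: (ltngtP a b) => [lab|lba|eab].
- exists (nc_split lab tab); rewrite nc_split_le nc_perm_split; split=> //.
  by apply: le_split => //; lia.
- have tba : nc_rel t b a by rewrite nc_rel_sym.
  exists (nc_split lba tba); rewrite nc_split_le nc_perm_split tpermC; split=> //.
  by apply: le_split => //; lia.
- by rewrite eab eqxx in nat_ab.
Qed.

(** * Geodesics and the Kreweras complement *)

Section Geodesic.
Variable n : nat.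
Implicit Types (s t : NC n).

Lemma nc_dist_ss s : nc_dist s s = 0.
Proof. by rewrite /nc_dist mulVg perm_length1. Qed.

Lemma nc_dist_sym s t : nc_dist s t = nc_dist t s.
Proof. by rewrite /nc_dist -perm_lengthV invMg invgK. Qed.

Lemma perm_neq_ex (p q : 'S_n) : p != q -> exists x, p x != q x.
Proof.
move=> pq; apply/existsP; apply: contraNT pq; rewrite negb_exists => /forallP e.
by apply/eqP/permP => x; apply/eqP; have := e x; rewrite negbK.
Qed.

Lemma nc_length_dist s t : nc_length t <= nc_dist s t + nc_length s.
Proof.
rewrite addnC /nc_length /nc_dist.
by rewrite -{1}(mulKVg (nc_perm s) (nc_perm t)) perm_lengthM.
Qed.

(** Induction on [nc_length t]: the [r] of [nc_interpolate] is shorter than [t] by one and at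
    distance at most one from it. The triangle inequality gives the other bound. *)
Lemma nc_dist_le s t : (s <= t)%O -> nc_dist s t + nc_length s = nc_length t.
Proof.
have [m] := ubnP (nc_length t); elim: m t => // m IHm t lt_m st.
apply/eqP; rewrite eqn_leq nc_length_dist andbT.
have [e|/perm_neq_ex[x ne]] := eqVneq (nc_perm s) (nc_perm t).
  by rewrite (nc_perm_inj e) nc_dist_ss.
have [r [sr rt pr]] := nc_interpolate st ne.
have lr : (nc_length r).+1 = nc_length t.
  rewrite /nc_length pr perm_length_split // porbit_nc_perm.
  apply: (nc_rel_trans (y := x)); last exact: nc_rel_perm.
  by rewrite nc_rel_sym; move/nc_le_rel: st; apply; apply: nc_rel_perm.
rewrite -lr -(IHm r) //; last by rewrite -ltnS lr.
rewrite -addSn leq_add2r /nc_dist.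
have -> : nc_perm t = (nc_perm r * tperm (nc_perm s x) (nc_perm t x))%g.
  by rewrite pr -mulgA tperm2 mulg1.
rewrite mulgA (leq_trans (perm_lengthM _ _)) // -addn1 leq_add2l.
(* A transposition has length 1 because it merges two fixed points of the identity. *)
have := @perm_length_merge _ (1 : 'S_n) (nc_perm s x) (nc_perm t x).
rewrite mul1g perm_length1 => -> //; apply/porbitP => -[i].
by rewrite expg1n perm1 => e; rewrite e eqxx in ne.
Qed.

(** Multiplying by the transposition [T] shortens [p^-1 * nc_perm t]; by the triangle inequality it
    then shortens [nc_perm t] too, so it splits a block of [t] and the induction applies to the
    result. *)
Lemma nc_geodesic (p : 'S_n) t :
  perm_length p + perm_length (p^-1 * nc_perm t) = nc_length t ->
  exists2 s, (s <= t)%O & nc_perm s = p.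
Proof.
have [m] := ubnP (nc_length t); elim: m t => // m IHm t lt_m geo.
have [->|/perm_neq_ex[x ne]] := eqVneq p (nc_perm t); first by exists t.
pose T := tperm (p x) (nc_perm t x).
have short : (perm_length (p^-1 * nc_perm t * T)).+1 = perm_length (p^-1 * nc_perm t).
  rewrite perm_length_split //.
  have -> : nc_perm t x = (p^-1 * nc_perm t)%g (p x) by rewrite permM permK.
  exact: (mem_porbit _ 1).
have le_r : perm_length (nc_perm t * T) < nc_length t.
  rewrite -geo -short addnS ltnS.
  by rewrite -{1}(mulKVg p (nc_perm t * T)%g) -mulgA perm_lengthM.
(* Otherwise [T] would merge two cycles and increase the length. *)
have rel_t : nc_rel t (p x) (nc_perm t x).
  apply: contraTT le_r; rewrite /nc_rel -porbit_nc_perm => /perm_length_merge ->.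
  by rewrite -leqNgt ltnW.
have [r rt pr] := nc_perm_split_ex ne rel_t.
have lr : (nc_length r).+1 = nc_length t.
  by rewrite /nc_length pr perm_length_split // porbit_nc_perm.
have [|| s sr ps] := IHm r; first by rewrite -ltnS lr.
  by apply/eqP; rewrite -eqSS lr -geo -short addnS pr mulgA.
by exists s => //; apply: le_trans rt.
Qed.

Lemma nc_le_dist s t : (s <= t)%O = (nc_dist s t + nc_length s == nc_length t).
Proof.
apply/idP/eqP => [/nc_dist_le //|]; rewrite addnC => /nc_geodesic[r rt e].
by rewrite -(nc_perm_inj e).
Qed.

(** The candidate lies on a geodesic to the top: what remains after it is a conjugate of
    [nc_perm s], of the same length. *)
Lemma nc_kreweras_ex s :
  exists t : NC n, nc_perm t == ((nc_perm s)^-1 * nc_perm \top%O)%g.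
Proof.
have [|t _ <-] := @nc_geodesic ((nc_perm s)^-1 * nc_perm \top%O)%g \top%O.
  by rewrite invMg invgK -mulgA -conjgE perm_lengthJ; apply: (nc_dist_le (lex1 s)).
by exists t.
Qed.

Definition nc_kreweras s : NC n := xchoose (nc_kreweras_ex s).

Lemma nc_perm_kreweras s :
  nc_perm (nc_kreweras s) = ((nc_perm s)^-1 * nc_perm \top%O)%g.
Proof. exact/eqP/(xchooseP (nc_kreweras_ex s)). Qed.

Lemma nc_kreweras_inj : injective nc_kreweras.
Proof.
move=> s t /(congr1 (@nc_perm n)); rewrite !nc_perm_kreweras => /mulIg/invg_inj.
exact: nc_perm_inj.
Qed.

(** The quotient of the two complements is conjugate to [s * t^-1], hence to [t^-1 * s]. *)
Lemma nc_dist_kreweras s t : nc_dist (nc_kreweras s) (nc_kreweras t) = nc_dist s t.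
Proof.
rewrite {1}/nc_dist !nc_perm_kreweras invMg invgK -mulgA (mulgA _ (nc_perm t)^-1%g).
rewrite -conjgE perm_lengthJ -(perm_lengthJ _ (nc_perm s)) conjgE !mulgA mulVg mul1g.
exact: (nc_dist_sym t s).
Qed.

Lemma nc_length_kreweras s :
  nc_length s + nc_length (nc_kreweras s) = nc_length (\top%O : NC n).
Proof.
by rewrite addnC {1}/nc_length nc_perm_kreweras; apply: (nc_dist_le (lex1 s)).
Qed.

(** By [nc_le_dist] the order is a matter of lengths and distances, and those of complements are
    known. *)
Lemma nc_le_kreweras s t : (nc_kreweras s <= nc_kreweras t)%O = (t <= s)%O.
Proof.
rewrite !nc_le_dist nc_dist_kreweras (nc_dist_sym t s).
by have := nc_length_kreweras s; have := nc_length_kreweras t; lia.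
Qed.

Lemma nc_kreweras_bot : nc_kreweras \bot%O = \top%O.
Proof.
(* An injective map of a finite type to itself is onto. *)
have [s es] : exists s, \top%O = nc_kreweras s.
  by exists (invF nc_kreweras_inj \top%O); rewrite f_invF.
by apply: le_anti; rewrite lex1 es nc_le_kreweras le0x.
Qed.

Lemma nc_kreweras_join s t :
  (nc_kreweras s `|` nc_kreweras t)%O = nc_kreweras (s `&` t)%O.
Proof.
apply: le_anti; rewrite leUx !nc_le_kreweras leIl leIr /=.
have [r er] : exists r, (nc_kreweras s `|` nc_kreweras t)%O = nc_kreweras r.
  by exists (invF nc_kreweras_inj (nc_kreweras s `|` nc_kreweras t)%O); rewrite f_invF.
rewrite er nc_le_kreweras lexI -!(nc_le_kreweras _ r) -er.
by rewrite leUl leUr.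
Qed.

End Geodesic.

Lemma nc_length_top n : nc_length (\top%O : NC n) = n.-1.
Proof.
rewrite /nc_length perm_lengthE card_ord; case: n => [|n]; first by rewrite sub0n.
have -> : porbits (nc_perm (\top%O : NC n.+1)) = [set [set: 'I_n.+1]].
  apply/setP => B; rewrite inE; apply/imsetP/eqP => [[x _ ->] | ->].
    by apply/setP => y; rewrite porbit_nc_perm inE; apply: nc_rel_top.
  by exists ord0 => //; apply/setP => y; rewrite porbit_nc_perm inE -/(nc_rel _ _ _) nc_rel_top.
by rewrite cards1 subn1.
Qed.

(** * Restriction to the blocks of a coarser partition *)

Lemma ltn_enum_val n (c : {set 'I_n}) (i j : 'I_#|c|) :
  (enum_val i < enum_val j) = (i < j).
Proof.
suff lt (k l : 'I_#|c|) : k < l -> enum_val k < enum_val l.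
  case: (ltngtP i j) => [/lt //|/lt ji|/val_inj->]; last by rewrite ltnn.
  by apply/negbTE; rewrite -leqNgt ltnW.
move=> kl; pose x0 := enum_val k; rewrite (enum_val_nth x0) (enum_val_nth x0 l).
rewrite -!(nth_map x0 (val x0) val) -?cardE //.
by apply: (sorted_ltn_nth ltn_trans) => //;
  rewrite ?sorted_enum_ord ?inE ?size_map -?cardE ?ltn_ord.
Qed.

Lemma leq_enum_val n (c : {set 'I_n}) (i j : 'I_#|c|) :
  (enum_val i <= enum_val j) = (i <= j).
Proof. by rewrite leqNgt ltn_enum_val -leqNgt. Qed.

Lemma enum_val_ex (T : finType) (c : {set T}) x : x \in c -> exists i : 'I_#|c|, x = enum_val i.
Proof. by move=> xc; exists (enum_rank_in xc x); rewrite enum_rankK_in. Qed.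

Section Restrict.
Variables (n : nat) (c : {set 'I_n}).
Implicit Types s t : NC n.

Section Def.
Variable s : NC n.
Let R (i j : 'I_#|c|) := nc_rel s (enum_val i) (enum_val j).
Let Rrefl : reflexive R. Proof. by move=> i; apply: nc_rel_refl. Qed.
Let Rsym : ssrbool.symmetric R. Proof. by move=> i j; apply: nc_rel_sym. Qed.
Let Rtrans : transitive R. Proof. by move=> j i k; apply: nc_rel_trans. Qed.
Let Rcross (i j k l : 'I_#|c|) :
  i < j -> j < k -> k < l -> R i k -> R j l -> R i j.
Proof. by rewrite -!ltn_enum_val; apply: nc_rel_cross. Qed.

(** Points of [c] are renumbered by [enum_val], which is increasing and so preserves the absence of
    crossings. *)
Definition nc_restrict : NC #|c| := nc_of_rel Rrefl Rsym Rtrans Rcross.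

Lemma nc_rel_restrict i j :
  nc_rel nc_restrict i j = nc_rel s (enum_val i) (enum_val j).
Proof. exact: nc_of_relE. Qed.
End Def.

Lemma nc_restrict_le s t : (s <= t)%O -> (nc_restrict s <= nc_restrict t)%O.
Proof.
by move=> /nc_le_rel st; apply/nc_le_rel => i j; rewrite !nc_rel_restrict => /st.
Qed.

Lemma nc_restrict_meet s t :
  nc_restrict (s `&` t)%O = (nc_restrict s `&` nc_restrict t)%O.
Proof.
by apply: nc_rel_inj => i j; rewrite nc_rel_meet !nc_rel_restrict nc_rel_meet.
Qed.

Lemma nc_restrict_bot : nc_restrict \bot%O = \bot%O.
Proof.
by apply: nc_rel_inj => i j; rewrite nc_rel_restrict !nc_rel_bot (inj_eq enum_val_inj).
Qed.

Variable sigma : NC n.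
Hypothesis sigma_c : c \in nc_blocks sigma.

Lemma nc_restrict_top : nc_restrict sigma = \top%O.
Proof.
apply: nc_rel_inj => i j; rewrite nc_rel_restrict nc_rel_top.
by rewrite (nc_relE _ sigma_c) enum_valP.
Qed.

(** A block of [s] meeting [c] is contained in [c], so it is renumbered as a whole and successors
    correspond. *)
Lemma nc_perm_restrict s i : (s <= sigma)%O ->
  enum_val (nc_perm (nc_restrict s) i) = nc_perm s (enum_val i).
Proof.
move=> /nc_le_rel s_sigma; apply/esym/nc_perm_uniq.
have [ij Hj] := nc_permP (nc_restrict s) i.
set j := nc_perm _ i in ij Hj *; split.
  by rewrite -/(nc_rel _ _ _) -nc_rel_restrict.
rewrite ltn_enum_val leq_enum_val.
have exk z : z \in pblock s (enum_val i) ->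
    exists2 k, z = enum_val k & k \in pblock (nc_restrict s) i.
  move=> iz; have /enum_val_ex[k ez] : z \in c.
    by rewrite -(nc_relE _ sigma_c (enum_valP i)); apply: s_sigma.
  by exists k => //; rewrite -/(nc_rel _ _ _) nc_rel_restrict -ez.
case: Hj => -[ij' Hj]; [left|right]; split=> // _ /exk[k -> /Hj];
  by rewrite !leq_enum_val.
Qed.

End Restrict.

(** * Additivity of the distance over blocks, by counting cycles *)

Lemma card_porbit_inj (T U : finType) (f : U -> T) (p : {perm T}) (q : {perm U}) x :
  injective f -> (forall y, f (q y) = p (f y)) -> #|porbit p (f x)| = #|porbit q x|.
Proof.
move=> f_inj fq; rewrite -(card_imset _ f_inj); apply: eq_card => z.
have fX i : f ((q ^+ i)%g x) = (p ^+ i)%g (f x).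
  by rewrite !permX; elim: i => //= i <-.
apply/porbitP/imsetP => [[i ->]|[y /porbitP[i ->] ->]].
  by exists ((q ^+ i)%g x); rewrite ?mem_porbit.
by exists i.
Qed.

Section Rat.
Local Open Scope ring_scope.

(** Each cycle of size k receives k terms 1/k. A sum over points splits over the blocks of a
    partition without any description of the set of cycles. *)
Lemma card_porbitsE (T : finType) (p : {perm T}) :
  #|porbits p|%:R = \sum_x (#|porbit p x|%:R)^-1 :> rat.
Proof.
rewrite (partition_big (porbit p) (mem (porbits p))) => [|x _] /=; last exact: imset_f.
rewrite -sum1_card natr_sum; apply: eq_bigr => _ /imsetP[x _ ->].
rewrite (eq_bigr (fun=> (#|porbit p x|%:R)^-1)) => [|y /eqP-> //].
rewrite (eq_bigl (mem (porbit p x))) => [|y]; last by rewrite eq_porbit_mem.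
rewrite sumr_const -[_ *+ #|_|]mulr_natl mulfV // Num.Theory.pnatr_eq0 -lt0n.
by apply/card_gt0P; exists x; apply: porbit_id.
Qed.

End Rat.

Lemma big_nc_blocks n (s : NC n) R (idx : R) (op : Monoid.com_law idx) (F : 'I_n -> R) :
  \big[op/idx]_x F x = \big[op/idx]_(c in nc_blocks s) \big[op/idx]_(i < #|c|) F (enum_val i).
Proof.
rewrite (partition_big (pblock s) (mem (nc_blocks s))) => [|x _] /=; last exact: nc_pblock.
apply: eq_bigr => c sc; rewrite -big_enum_val; apply: eq_bigl => x /=.
apply/eqP/idP => [<-|]; first exact: nc_mem_pblock.
exact: (def_pblock (nc_triv s)).
Qed.

Lemma nc_dist_restrict n (sigma s t : NC n) : (s <= sigma)%O -> (t <= sigma)%O ->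
  nc_dist s t = \sum_(c in nc_blocks sigma) nc_dist (nc_restrict c s) (nc_restrict c t).
Proof.
move=> s_sigma t_sigma; rewrite /nc_dist.
under eq_bigr => c _ do rewrite perm_lengthE card_ord.
rewrite perm_lengthE card_ord sumnB => [|c _]; last first.
  by rewrite -[X in _ <= X]card_ord leq_card_porbits.
congr (_ - _).
  rewrite -{1}(card_ord n) -sum1_card (big_nc_blocks sigma).
  by apply: eq_bigr => c _; rewrite sum1_card card_ord.
apply: (@Num.Theory.mulrIn rat 1%R); first exact: GRing.oner_neq0.
rewrite natr_sum card_porbitsE (big_nc_blocks sigma); apply: eq_bigr => c sc.
rewrite card_porbitsE; apply: eq_bigr => i _; congr (_%:R^-1)%R.
apply: card_porbit_inj => [|j]; first exact: enum_val_inj.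
rewrite !permM (nc_perm_restrict sc _ t_sigma); congr (nc_perm t _).
apply: (canRL (permK _)); rewrite -(nc_perm_restrict sc _ s_sigma).
by rewrite permKV.
Qed.

(** * Gluing partitions of the blocks: the inverse of restriction *)

Section Glue.
Variables (n : nat) (sigma : NC n).
Let I := {c : {set 'I_n} | c \in nc_blocks sigma}.

Lemma nc_blocks_enum_val (a b : I) (i : 'I_#|val a|) (j : 'I_#|val b|) :
  enum_val i = enum_val j -> a = b.
Proof.
move=> e; apply: val_inj; apply: (nc_eq_block (valP a) (valP b) (enum_valP i)).
by rewrite e enum_valP.
Qed.

Lemma nc_blocks_ex x : exists (c : I) (i : 'I_#|val c|), x = enum_val i.
Proof.
exists (Sub (pblock sigma x) (nc_pblock sigma x)).
exact: (enum_val_ex (nc_mem_pblock sigma x)).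
Qed.

Section Def.
Variable u : forall c : I, NC #|val c|.
(** Witnesses are quantified because the type of [u c] depends on the block [c]. *)
Let R x y := [exists c : I, exists i, exists j,
  [&& x == enum_val i, y == enum_val j & nc_rel (u c) i j]].

Let RP x y : reflect
  (exists c i j, [/\ x = enum_val i, y = enum_val j & nc_rel (u c) i j]) (R x y).
Proof.
apply: (iffP existsP) => [[c /existsP[i /existsP[j /and3P[/eqP ex /eqP ey uij]]]]|].
  by exists c, i, j.
move=> [c [i [j [-> -> uij]]]]; exists c; apply/existsP; exists i.
by apply/existsP; exists j; rewrite !eqxx.
Qed.

Let R_val (c : I) (i j : 'I_#|val c|) :
  R (enum_val i) (enum_val j) = nc_rel (u c) i j.
Proof.
apply/RP/idP => [[d [k [l [eik ejl ukl]]]]|]; last by exists c, i, j.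
have ecd := nc_blocks_enum_val eik; case: d / ecd k l eik ejl ukl => k l.
by move=> /enum_val_inj-> /enum_val_inj->.
Qed.

Let R_sigma x y : R x y -> nc_rel sigma x y.
Proof.
by move=> /RP[c [i [j [-> -> _]]]]; rewrite (nc_relE _ (valP c)) enum_valP.
Qed.

Let same_block (c : I) (i : 'I_#|val c|) y :
  nc_rel sigma (enum_val i) y -> exists j : 'I_#|val c|, y = enum_val j.
Proof. by rewrite (nc_relE _ (valP c)) ?enum_valP // => /enum_val_ex. Qed.

Let Rrefl : reflexive R.
Proof. by move=> x; have [c [i ->]] := nc_blocks_ex x; rewrite R_val nc_rel_refl. Qed.

Let Rsym : ssrbool.symmetric R.
Proof.
suff sub x y : R x y -> R y x by move=> x y; apply/idP/idP; apply: sub.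
by move=> /RP[c [i [j [-> -> uij]]]]; rewrite R_val nc_rel_sym.
Qed.

Let Rtrans : transitive R.
Proof.
move=> y x z xy yz; have [c [i [j [ex ey _]]]] := RP _ _ xy.
have [k ez] : exists k : 'I_#|val c|, z = enum_val k.
  by apply: (same_block (i := j)); rewrite -ey R_sigma.
by move: xy yz; rewrite ex ey ez !R_val; apply: nc_rel_trans.
Qed.

Let Rcross (a b c d : 'I_n) :
  a < b -> b < c -> c < d -> R a c -> R b d -> R a b.
Proof.
move=> ab bc cd ac bd; have [e [i [k [ea ec _]]]] := RP _ _ ac.
(* Non-crossing of [sigma] puts [b], and then [d], in the block of [a] and [c], where the hypothesis
   on a single [u e] applies. *)
have [j eb] : exists j : 'I_#|val e|, b = enum_val j.
  apply: (same_block (i := i)); rewrite -ea.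
  by apply: nc_rel_cross ab bc cd _ _; apply: R_sigma.
have [l ed] : exists l : 'I_#|val e|, d = enum_val l.
  by apply: (same_block (i := j)); rewrite -eb R_sigma.
move: ab bc cd ac bd; rewrite ea eb ec ed !ltn_enum_val !R_val.
exact: nc_rel_cross.
Qed.

Definition nc_glue : NC n := nc_of_rel Rrefl Rsym Rtrans Rcross.

Lemma nc_rel_glue (c : I) (i j : 'I_#|val c|) :
  nc_rel nc_glue (enum_val i) (enum_val j) = nc_rel (u c) i j.
Proof. by rewrite nc_of_relE R_val. Qed.

Lemma nc_glue_le : (nc_glue <= sigma)%O.
Proof. by apply/nc_le_rel => x y; rewrite nc_of_relE => /R_sigma. Qed.

Lemma nc_restrict_glue c : nc_restrict (val c) nc_glue = u c.
Proof. by apply: nc_rel_inj => i j; rewrite nc_rel_restrict nc_rel_glue. Qed.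

End Def.

(** Dependent families need only agree pointwise, so no function extensionality is used. *)
Lemma eq_nc_glue (u u' : forall c : I, NC #|val c|) :
  (forall c, u c = u' c) -> nc_glue u = nc_glue u'.
Proof.
move=> uu'; apply: nc_rel_inj => x y; rewrite !nc_of_relE.
by do 3!apply: eq_existsb => ?; rewrite uu'.
Qed.

Lemma nc_le_restrict (s t : NC n) : (s <= sigma)%O ->
  (forall c, c \in nc_blocks sigma -> (nc_restrict c s <= nc_restrict c t)%O) ->
  (s <= t)%O.
Proof.
move=> /nc_le_rel s_sigma st; apply/nc_le_rel => x y xy.
have [c [i ex]] := nc_blocks_ex x.
have /enum_val_ex[j ey] : y \in val c.
  by rewrite -(nc_relE _ (valP c) (enum_valP i)) -ex s_sigma.
have /nc_le_rel/(_ i j) := st _ (valP c); rewrite !nc_rel_restrict -ex -ey.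
exact.
Qed.

Lemma nc_glue_restrict (s : NC n) : (s <= sigma)%O ->
  nc_glue (fun c => nc_restrict (val c) s) = s.
Proof.
move=> s_sigma; apply: le_anti; apply/andP; split.
  apply: nc_le_restrict => [|c sc]; first exact: nc_glue_le.
  by rewrite (nc_restrict_glue _ (Sub c sc)).
by apply: nc_le_restrict => // c sc; rewrite (nc_restrict_glue _ (Sub c sc)).
Qed.

Lemma nc_meet_restrict (s t : NC n) : (s <= sigma)%O -> (t <= sigma)%O ->
  ((s `&` t)%O == \bot%O) = [forall (c | c \in nc_blocks sigma),
    (nc_restrict c s `&` nc_restrict c t)%O == \bot%O].
Proof.
move=> s_sigma t_sigma; apply/eqP/forall_inP => [st c sc | st].
  by rewrite -nc_restrict_meet st nc_restrict_bot.
apply: le_anti; rewrite le0x andbT; apply: nc_le_restrict => [|c sc].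
  by rewrite leIxl.
by rewrite nc_restrict_meet (eqP (st c sc)) le0x.
Qed.

Lemma nc_join_restrict (s t : NC n) : (s <= sigma)%O -> (t <= sigma)%O ->
  ((s `|` t)%O == sigma) = [forall (c | c \in nc_blocks sigma),
    (nc_restrict c s `|` nc_restrict c t)%O == \top%O].
Proof.
move=> s_sigma t_sigma; apply/eqP/forall_inP => [st c sc | st].
  (* The blockwise joins glue to an upper bound of [s] and [t], hence one of [sigma]. *)
  pose u := nc_glue (fun d => nc_restrict (val d) s `|` nc_restrict (val d) t)%O.
  have uE d (sd : d \in nc_blocks sigma) :
    nc_restrict d u = (nc_restrict d s `|` nc_restrict d t)%O.
    exact: (nc_restrict_glue _ (Sub d sd)).
  have : (sigma <= u)%O.
    rewrite -st leUx; apply/andP; split; apply: nc_le_restrict => // d sd;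
    by rewrite uE // ?leUl ?leUr.
  move=> /(nc_restrict_le c); rewrite uE // (nc_restrict_top sc) => ?.
  by apply/eqP/le_anti; rewrite lex1.
apply: le_anti; rewrite leUx s_sigma t_sigma /=.
apply: nc_le_restrict => // c sc; rewrite (nc_restrict_top sc) -(eqP (st c sc)).
by rewrite leUx !nc_restrict_le ?leUl ?leUr.
Qed.

End Glue.

(** * Expanding a product of sums over the blocks *)

Section Distribution.
Local Open Scope ring_scope.

Lemma prod_sum_fprod (R : comPzRingType) (I : finType) (T_ : I -> finType)
    (P : forall i, T_ i -> R) :
  \prod_i \sum_(j : T_ i) P i j = \sum_(t : fprod T_) \prod_i P i (t i).
Proof.
pose P' i : {ffun T_ i -> R} := [ffun j => P i j].
transitivity (\sum_(t : fprod T_) \prod_i P' i (t i)); last first.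
  by apply: eq_bigr => t _; apply: eq_bigr => i _; rewrite ffunE.
rewrite big_fprod; apply/esym.
(* Dependent families become functions into tagged values; the 0 in [untag] is the value at a wrong
   tag. *)
rewrite -(bigA_distr_big_dep (fun i => tagged_with T_ i)
  (fun i => untag 0 (P' i))); apply/esym/eq_bigr => i _.
by rewrite -(big_tag (fun i => P' i)); apply: eq_bigr => j _; rewrite ffunE.
Qed.

(** Restriction and gluing are inverse bijections between the interval below [sigma] and the
    families of partitions of its blocks; they are applied to both members of a pair at once. *)
Lemma sum_nc_interval (R : comPzRingType) n (sigma : NC n)
    (w : forall k, NC k -> NC k -> R) :
  \sum_(s : NC n | (s <= sigma)%O) \sum_(t : NC n | (t <= sigma)%O)
    \prod_(c in nc_blocks sigma) w _ (nc_restrict c s) (nc_restrict c t) =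
  \prod_(c in nc_blocks sigma) \sum_s \sum_t w #|c| s t.
Proof.
pose I := {c : {set 'I_n} | c \in nc_blocks sigma}.
pose T_ (c : I) : finType := (NC #|val c| * NC #|val c|)%type.
rewrite pair_big [RHS]big_sub.
under [RHS]eq_bigr => c _ do rewrite pair_big.
rewrite (prod_sum_fprod (T_ := T_) (fun c p => w _ p.1 p.2)).
rewrite (reindex_onto
  (fun t : fprod T_ => (nc_glue (fun c => (t c).1), nc_glue (fun c => (t c).2)))
  (fun p => fprod_of_fun (T_ := T_)
     (fun c => (nc_restrict (val c) p.1, nc_restrict (val c) p.2)))) /=; last first.
  move=> [s t] /= /andP[ss ts]; rewrite -[in RHS](nc_glue_restrict ss).
  rewrite -[in RHS](nc_glue_restrict ts).
  by congr (_, _); apply: eq_nc_glue => c; rewrite fprodE.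
rewrite (eq_bigl predT) => [|f]; last first.
  rewrite !nc_glue_le /=; apply/eqP/fprodP => c; rewrite fprodE !nc_restrict_glue.
  by case: (f c).
apply: eq_bigr => f _; rewrite big_sub; apply: eq_bigr => c _.
by rewrite !nc_restrict_glue.
Qed.

End Distribution.

(** * The transformation of the polynomials *)

Lemma nc_length_bot n : nc_length (\bot%O : NC n) = 0.
Proof. by have := nc_length_kreweras (\bot%O : NC n); rewrite nc_kreweras_bot; lia. Qed.

(** This makes additivity of lengths a case of additivity of distances. *)
Lemma nc_lengthE n (s : NC n) : nc_length s = nc_dist \bot%O s.
Proof. by rewrite -(nc_dist_le (le0x s)) nc_length_bot addn0. Qed.

(** The exponents of A and B in [f_poly] are thus distances to the top, which is how those of
    [g_poly] restrict to a block. *)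
Lemma nc_dist_top n (s : NC n) : nc_dist s \top%O = n.-1 - nc_length s.
Proof. by rewrite -(nc_length_top n) -(nc_dist_le (lex1 s)) addnK. Qed.

Lemma nc_length_restrict n (sigma s : NC n) : (s <= sigma)%O ->
  nc_length s = \sum_(c in nc_blocks sigma) nc_length (nc_restrict c s).
Proof.
move=> s_sigma; rewrite nc_lengthE (nc_dist_restrict (le0x sigma) s_sigma).
by apply: eq_bigr => c _; rewrite nc_restrict_bot nc_lengthE.
Qed.

Lemma nc_dist_sup_restrict n (sigma s : NC n) : (s <= sigma)%O ->
  nc_dist s sigma =
  \sum_(c in nc_blocks sigma) (#|c|.-1 - nc_length (nc_restrict c s)).
Proof.
move=> s_sigma; rewrite (nc_dist_restrict s_sigma (lexx sigma)).
by apply: eq_bigr => c sc; rewrite (nc_restrict_top sc) nc_dist_top.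
Qed.

Local Open Scope ring_scope.

(** The bounds by [sigma] follow from the join condition; they make the ranges intervals, as
    [sum_nc_interval] requires, while the condition itself goes into the weight. *)
Lemma sum_by_join (R : comPzRingType) n (F : NC n -> NC n -> R) :
  \sum_s \sum_t F s t =
  \sum_sigma \sum_(s : NC n | (s <= sigma)%O) \sum_(t : NC n | (t <= sigma)%O)
    if (s `|` t)%O == sigma then F s t else 0.
Proof.
rewrite pair_big /= (partition_big (fun p : NC n * NC n => p.1 `|` p.2)%O predT) //=.
apply: eq_bigr => sigma _; rewrite pair_big /= -big_mkcondr /=.
apply: eq_bigl => p; apply/eqP/andP => [<-|[_ /eqP] //].
by rewrite leUl leUr eqxx.
Qed.

Lemma prod_if (R : comPzRingType) (I : finType) (S : {set I}) (b : pred I) (F : I -> R) :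
  \prod_(i in S) (if b i then F i else 0) =
  if [forall (i | i \in S), b i] then \prod_(i in S) F i else 0.
Proof.
case: ifPn => [/forall_inP bS | ]; first by apply: eq_bigr => i /bS->.
rewrite negb_forall => /existsP[i]; rewrite negb_imply => /andP[iS /negPf bi].
by rewrite (bigD1 i) //= bi mul0r.
Qed.

Lemma f_polyE n : f_poly n =
  \sum_(s : NC n) \sum_(t : NC n | (s `&` t)%O == \bot%O)
    Yvar ^+ nc_dist s t * Avar ^+ nc_length s * Bvar ^+ nc_length t.
Proof.
rewrite /f_poly (reindex_inj (@nc_kreweras_inj n)); apply: eq_bigr => s _.
rewrite (reindex_inj (@nc_kreweras_inj n)); apply: eq_big => [t|t _].
  by rewrite nc_kreweras_join -nc_kreweras_bot (inj_eq (@nc_kreweras_inj n)).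
by rewrite nc_dist_kreweras -nc_length_top -{1}(nc_length_kreweras s) 
  -(nc_length_kreweras t) !addnK.
Qed.

Lemma f_poly_transform n : f_poly n = nc_transform e_poly n.
Proof.
rewrite f_polyE; under eq_bigr => s _ do rewrite big_mkcond.
rewrite sum_by_join; apply: eq_bigr => sigma _.
(* The summand of [e_poly], extended by 0 to all pairs so that its conditions multiply over the
   blocks. *)
pose w k (s t : NC k) := if ((s `&` t)%O == \bot%O) && ((s `|` t)%O == \top%O)
  then Yvar ^+ nc_dist s t * Avar ^+ nc_length s * Bvar ^+ nc_length t else 0.
transitivity (\prod_(c in nc_blocks sigma) \sum_s \sum_t w #|c| s t); last first.
  by apply: eq_bigr => c _; apply: eq_bigr => s _; rewrite -big_mkcond.
rewrite -sum_nc_interval; apply: eq_bigr => s ss; apply: eq_bigr => t ts.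
rewrite /w prod_if !big_split !prodrXr -(nc_dist_restrict ss ts).
rewrite -(nc_length_restrict ss) -(nc_length_restrict ts).
have -> : [forall (c | c \in nc_blocks sigma),
    ((nc_restrict c s `&` nc_restrict c t)%O == \bot%O) &&
    ((nc_restrict c s `|` nc_restrict c t)%O == \top%O)] =
    ((s `&` t)%O == \bot%O) && ((s `|` t)%O == sigma).
  rewrite (nc_meet_restrict ss ts) (nc_join_restrict ss ts).
  apply/forall_inP/andP => [st | [/forall_inP mst /forall_inP jst] c sc].
    by split; apply/forall_inP => c /st/andP[].
  by rewrite mst ?jst.
by case: (_ == \bot%O); case: (_ == sigma).
Qed.

Lemma g_poly_transform n : g_poly n = nc_transform f_poly n.
Proof.
rewrite /g_poly sum_by_join; apply: eq_bigr => sigma _.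
pose w k (s t : NC k) := if (s `|` t)%O == \top%O
  then Yvar ^+ nc_dist s t * Avar ^+ (k.-1 - nc_length s) *
       Bvar ^+ (k.-1 - nc_length t) else 0.
transitivity (\prod_(c in nc_blocks sigma) \sum_s \sum_t w #|c| s t); last first.
  by apply: eq_bigr => c _; apply: eq_bigr => s _; rewrite -big_mkcond.
rewrite -sum_nc_interval; apply: eq_bigr => s ss; apply: eq_bigr => t ts.
rewrite /w prod_if !big_split !prodrXr -(nc_dist_restrict ss ts).
rewrite -(nc_dist_sup_restrict ss) -(nc_dist_sup_restrict ts).
(* Where the summand survives, the join in the exponents of [g_poly] is [sigma]. *)
by rewrite -(nc_join_restrict ss ts); case: eqP => // ->.
Qed.

Theorem theorem5p1 :
  (forall n : nat, (0 < n)%N -> f_poly n = nc_transform e_poly n) /\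
  (forall n : nat, (0 < n)%N -> g_poly n = nc_transform f_poly n).
Proof.
by split=> n _; [apply: f_poly_transform | apply: g_poly_transform].
Qed.
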